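(* Let $a\le x<y\le y'<x'\le b$ be real numbers with $x+x'=y+y'$, let $\Omega=[x,y]\cup[y',x']$, let $f:[a,b]\to\mathbb{R}$ be convex, and let $p:[x,x']\to[0,\infty)$ be integrable and symmetric about $\frac{x+x'}{2}$. Let $\mathrm{Lp}_1,\mathrm{Pp}_1,G_1,G_2,\mathrm{Hp}_1,\mathrm{Hp}_2,\mathrm{Fp}_1:[0,1]\to\mathbb{R}$ be the functions defined in the context. Then: (1) $\mathrm{Lp}_1$ is convex on $[0,1]$. (2) $$\frac{G_1(t)+G_2(t)}{2}\int_\Omega p(s)\,ds\le \mathrm{Lp}_1(t)\le \mathrm{Pp}_1(t)\qquad(t\in[0,1])$$ and $$\sup_{t\in[0,1]}\mathrm{Lp}_1(t)=\mathrm{Lp}_1(1)=\frac{f(x)+f(x')}{2}\int_\Omega p(s)\,ds.$$ (3) For all $t\in[0,1]$: $$\frac{\mathrm{Hp}_1(1-t)+\mathrm{Hp}_2(1-t)}{2}\int_\Omega p(s)\,ds\le \mathrm{Fp}_1(t)\le \mathrm{Lp}_1(t)\int_\Omega p(s)\,ds,$$ $$\frac{\mathrm{Hp}_1(t)+\mathrm{Hp}_2(t)}{2}\int_\Omega p(s)\,ds\le \mathrm{Fp}_1(t)\le \mathrm{Lp}_1(t)\int_\Omega p(s)\,ds,$$ $$\frac{\mathrm{Hp}_1(t)+\mathrm{Hp}_2(t)+\mathrm{Hp}_1(1-t)+\mathrm{Hp}_2(1-t)}{4}\int_\Omega p(s)\,ds\le \mathrm{Fp}_1(t)\le \mathrm{Lp}_1(t)\int_\Omega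 p(s)\,ds.$$ (4) If $p(s)=p(x+x'-s)$ for $s\in[x,y]$ and $p(s)=p(x+y-s)$ for $s\in\left[x,\frac{x+y}{2}\right]$, then for all $t\in[0,1]$ $$0\le \mathrm{Fp}_1(t)-\frac{\mathrm{Hp}_1(t)+\mathrm{Hp}_2(t)}{2}\int_\Omega p(s)\,ds\le \mathrm{Lp}_1(1-t)\int_\Omega p(s)\,ds-\mathrm{Fp}_1(t).$$
   Context: Symmetric about $\frac{x+x'}{2}$ means $p(s)=p(x+x'-s)$ for $s\in[x,x']$. For $t\in[0,1]$ define $$\mathrm{Hp}_1(t)=\int_x^y\left[f(ts+(1-t)y)+f(t(y+y'-s)+(1-t)y')\right]p(s)\,ds,$$ $$\mathrm{Hp}_2(t)=\int_x^y\left[f(ts+(1-t)y')+f(t(y+y'-s)+(1-t)y)\right]p(s)\,ds,$$ $$\mathrm{Fp}_1(t)=\int_\Omega\int_\Omega f(ts+(1-t)u)p(s)p(u)\,ds\,du,$$ $$\mathrm{Pp}_1(t)=\int_x^y\left[f(tx+(1-t)s)+f(tx'+(1-t)(x+x'-s))\right]p(s)\,ds,$$ $$\mathrm{Lp}_1(t)=\frac12\int_\Omega\left[f(tx+(1-t)s)+f(tx'+(1-t)s)\right]p(s)\,ds,$$ $$G_1(t)=\frac12\left[f(tx+(1-t)y)+f(tx'+(1-t)y')\right],\qquad G_2(t)=\frac12\left[f(tx+(1-t)y')+f(tx'+(1-t)y)\right].$$ *)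

(* Defs.v *)
From HB Require Import structures.
From mathcomp Require Import all_boot all_order all_algebra.
From mathcomp Require Import all_classical all_reals all_analysis.

Set Implicit Arguments.
Unset Strict Implicit.
Unset Printing Implicit Defensive.

Import Order.TTheory GRing.Theory Num.Theory.
Import numFieldNormedType.Exports.
Local Open Scope classical_set_scope.
Local Open Scope ring_scope.

(* The completed measure makes "integrable" mean Lebesgue integrable:
   [lebesgue_measure] lives on the Borel sets, so integrability with respect to
   it would force the weight [p] to be Borel measurable. *)
Notation leb := completed_lebesgue_measure.

Section Functionals.
Context {R : realType}.
Implicit Types (f p : R -> R) (x y t : R).

(* [f] and [p] are total functions; under the constraints
   a <= x < y <= y' < x' <= b and 0 <= t <= 1, all integrands below only use
   the values of [f] on [a, b] and of [p] on [x, x']. *)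

Definition Omega x y y' x' : set R := `[x, y] `|` `[y', x'].

Definition Hp1 f p x y y' t : R :=
  \int[leb]_(s in `[x, y])
    ((f (t * s + (1 - t) * y) + f (t * (y + y' - s) + (1 - t) * y')) * p s).

Definition Hp2 f p x y y' t : R :=
  \int[leb]_(s in `[x, y])
    ((f (t * s + (1 - t) * y') + f (t * (y + y' - s) + (1 - t) * y)) * p s).

Definition Fp1 f p x y y' x' t : R :=
  \int[leb]_(u in Omega x y y' x') \int[leb]_(s in Omega x y y' x')
    (f (t * s + (1 - t) * u) * p s * p u).

Definition Pp1 f p x y x' t : R :=
  \int[leb]_(s in `[x, y])
    ((f (t * x + (1 - t) * s) + f (t * x' + (1 - t) * (x + x' - s))) * p s).

Definition Lp1 f p x y y' x' t : R :=
  2^-1 * \int[leb]_(s in Omega x y y' x')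
    ((f (t * x + (1 - t) * s) + f (t * x' + (1 - t) * s)) * p s).

Definition G1 f x y y' x' t : R :=
  2^-1 * (f (t * x + (1 - t) * y) + f (t * x' + (1 - t) * y')).

Definition G2 f x y y' x' t : R :=
  2^-1 * (f (t * x + (1 - t) * y') + f (t * x' + (1 - t) * y)).

End Functionals.

(* Main.v *)
(* Write W g for the integral of g p over Omega. Reflecting s to x + x' - s
   folds Omega onto [x, y], where convexity compares the pairs (y, y'),
   (s, x + x' - s) and (x, x'), nested and with the same sum; hence the Fejer
   inequalities (g y + g y') / 2 * P <= W g <= (g x + g x') / 2 * P for g convex.
   The functionals of the theorem are values of W at convex functions:
   F u = W (fun s => f (t s + (1 - t) u)) is convex, Fp1 t = W F,
   Hp1 t + Hp2 t = F y + F y' and 2 Lp1 (1 - t) = F x + F x'. Applying the Fejer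
   inequalities to the inner or to the outer integral of Fp1 gives both lower
   bounds without exchanging the integrals. In (4), p is also symmetric on
   [x, y], which improves the upper bound to
   W g <= (g x + g x' + g y + g y') / 4 * P. *)
Require Import Defs.
From HB Require Import structures.
From mathcomp Require Import all_boot all_order all_algebra.
From mathcomp Require Import all_classical all_reals all_analysis.
From mathcomp Require Import measurable_realfun ring lra.

Set Implicit Arguments.
Unset Strict Implicit.
Unset Printing Implicit Defensive.

Import Order.TTheory GRing.Theory Num.Theory.
Import numFieldNormedType.Exports.
Local Open Scope classical_set_scope.
Local Open Scope ring_scope.

(** * Reflection invariance of the completed Lebesgue measure *)

Local Notation completedR R := (caratheodory_type (@wlength R idfun)^*%mu).

Lemma measurable_completedR (R : realType) (A : set R) :
  measurable A -> measurable (A : set (completedR R)).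
Proof. exact: sub_caratheodory. Qed.

(** The pushforward gives every generating interval []l, u]] its length, and uniqueness of Lebesgue
    measure does the rest. The reflected interval is closed on the left instead of the right, with
    the same length. *)
Lemma lebesgue_measure_reflection (R : realType) (c : R) (A : set R) :
  measurable A ->
  pushforward lebesgue_measure ((fun s => c - s) : _ -> measurableTypeR R) A =
  lebesgue_measure A.
Proof.
move=> mA; apply/esym/lebesgue_measure_unique => //=.
  by apply: measurable_funB.
move=> _ _ [[l u]] _ <-.
rewrite /pushforward.
rewrite (_ : _ @^-1` _ = `[c - u, c - l[%classic); last first.
  apply/seteqP; split => s /=; rewrite !in_itv/=; lra.
rewrite !lebesgue_measure_itv/= !lte_fin ltrD2l ltrN2 -!EFinB.
by congr (if _ then _%:E else _); ring.
Qed.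

(** [N] need not be Borel, so the argument runs in the outer measure: subadditivity with a Borel
    null cover of [N] bounds it above, monotonicity below. *)
Lemma lebU_negligible (R : realType) (A N : set R) :
  lebesgue_measure.-negligible N -> leb (A `|` N) = lebesgue_measure A.
Proof.
move=> [F [mF F0 NF]]; apply/eqP; rewrite eq_le; apply/andP; split.
  apply: (le_trans (outer_measureU2 (wlength idfun)^*%mu A N)).
  rewrite -[leRHS]adde0 leeD2l// -F0; exact: le_outer_measure.
exact: (le_outer_measure (wlength idfun)^*%mu).
Qed.

(* A completed measurable set is the union of a Borel and a negligible set, so
   the invariance of the Borel measure extends to the completion. *)
Lemma completed_reflection (R : realType) (c : R) (A : set (completedR R)) :
  measurable A ->
  measurable ((fun s => c - s) @^-1` A : set (completedR R)) /\
  leb ((fun s => c - s) @^-1` A : set (completedR R)) = leb A.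
Proof.
pose phi : R -> R := fun s => c - s.
have mphi (B : set R) : measurable B -> measurable (phi @^-1` B).
  move=> mB; rewrite -[X in measurable X]setTI.
  by apply: measurable_funB.
rewrite -completed_caratheodory_measurable g_sigma_completed_algebra_genE.
move=> [/= B mB [N negN <-{A}]].
have negphiN : lebesgue_measure.-negligible (phi @^-1` N).
  move: negN => [F [mF F0 NF]]; exists (phi @^-1` F); split.
  - exact: mphi.
  - by rewrite -[RHS]F0; exact: lebesgue_measure_reflection.
  - exact: preimage_subset.
rewrite preimage_setU; split.
  by exists (phi @^-1` B); [exact: mphi | exists (phi @^-1` N)].
rewrite (lebU_negligible _ negN) (lebU_negligible _ negphiN).
exact: lebesgue_measure_reflection.
Qed.

Section measure_preserving.
Context d (T : measurableType d) (R : realType).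
Context (mu : {measure set T -> \bar R}) (phi : T -> T).
Context (mphi : measurable_fun setT phi).
Context (muphi : forall A, measurable A -> mu (phi @^-1` A) = mu A).
Local Open Scope ereal_scope.

Lemma ge0_integral_measure_preserving (D : set T) (f : T -> \bar R) :
  measurable D -> measurable_fun D f -> {in D, forall s, 0 <= f s} ->
  \int[mu]_(s in D) f s = \int[mu]_(s in phi @^-1` D) f (phi s).
Proof.
move=> mD mf f0; rewrite -(ge0_integral_pushforward mphi)//.
by apply: eq_measure_integral => A mA _; exact/esym/muphi.
Qed.

(** Composition with [phi] commutes with taking positive and negative parts, and the nonnegative
    case applies to each part. *)
Lemma integral_measure_preserving (D : set T) (f : T -> \bar R) :
  measurable D -> measurable_fun D f ->
  \int[mu]_(s in D) f s = \int[mu]_(s in phi @^-1` D) f (phi s).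
Proof.
move=> mD mf; rewrite integralE [RHS]integralE.
congr (_ - _); rewrite ge0_integral_measure_preserving//.
- by rewrite (funepos_comp f phi).
- exact: measurable_funepos.
- by rewrite (funeneg_comp f phi).
- exact: measurable_funeneg.
Qed.

End measure_preserving.

(** Used with [c = x + x'] to fold [Omega] onto [[x, y]], and with [c = x + y] to reverse
    [[x, y]]. *)
Lemma Rintegral_reflection (R : realType) (c : R) (D : set (completedR R))
    (h : R -> R) : measurable D -> leb.-integrable D (EFin \o h) ->
  \int[leb]_(s in D) h s = \int[leb]_(s in (fun s => c - s) @^-1` D) h (c - s).
Proof.
move=> mD /measurable_int mh; rewrite /Rintegral.
rewrite (integral_measure_preserving (T := completedR R)
  (phi := fun s => c - s) _ _ mD mh).
- by [].
- by move=> _ A mA; rewrite setTI; apply: (completed_reflection c mA).1.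
- by move=> A mA; exact: (completed_reflection c mA).2.
Qed.

(** * Convex functions on a segment: nested pairs, measurability, boundedness *)

Section convex.
Context {R : realType}.
Implicit Types (D : set R) (f g h p : R -> R) (l r s t u v : R).

Lemma convex_functionP D g :
  convex_function D g <->
  forall t u v, 0 <= t <= 1 -> D u -> D v ->
    g (t * u + (1 - t) * v) <= t * g u + (1 - t) * g v.
Proof.
split => [cg t u v t01 Du Dv|cg t u v /set_mem Du /set_mem Dv].
  case/andP: t01 => t0 t1.
  exact: (cg (Itv01 t0 t1) u v (mem_set Du) (mem_set Dv)).
by apply: (cg t%:num u v) => //; rewrite ge0 le1.
Qed.

Lemma segment_conv u s v : u <= s <= v ->
  exists2 t, 0 <= t <= 1 & s = t * u + (1 - t) * v.
Proof.
move=> /andP[us sv]; have [uv|uv] := eqVneq u v.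
  by exists 0; rewrite ?lexx ?ler01//; lra.
have d0 : 0 < v - u by rewrite subr_gt0 lt_neqAle uv (le_trans us).
exists ((v - s) / (v - u)).
  by rewrite divr_ge0 ?ler_pdivrMr//; lra.
by field; rewrite gt_eqF.
Qed.

(** If [s] has weights [t], [1 - t] on [u], [v], then [s'] has the swapped weights, so the two
    convexity inequalities add up to [g u + g v]. *)
Lemma convex_sum_le l r g u s s' v : convex_function `[l, r]%classic g ->
  l <= u -> u <= s <= v -> v <= r -> u + v = s + s' ->
  g s + g s' <= g u + g v.
Proof.
move=> /convex_functionP cg lu /[dup] usv /segment_conv[t t01 sE] vr e.
have Du : `[l, r]%classic u by rewrite /= in_itv/=; lra.
have Dv : `[l, r]%classic v by rewrite /= in_itv/=; lra.
have -> : s' = t * v + (1 - t) * u by lra.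
by have := cg _ _ _ t01 Du Dv; have := cg _ _ _ t01 Dv Du; rewrite -sE; lra.
Qed.

(** Here [h] is affine. This serves for the reflections and for the kernel [f (t * s + (1 - t) * u)]
    in each of its three variables. *)
Lemma convex_comp D D' g h : convex_function D g ->
  (forall t u v, h (t * u + (1 - t) * v) = t * h u + (1 - t) * h v) ->
  (forall s, D' s -> D (h s)) -> convex_function D' (fun s => g (h s)).
Proof.
move=> /convex_functionP cg hE D'D; apply/convex_functionP => t u v t01 D'u D'v.
by rewrite hE; apply: cg => //; exact: D'D.
Qed.

Lemma convex_functionD D g1 g2 : convex_function D g1 ->
  convex_function D g2 -> convex_function D (fun s => g1 s + g2 s).
Proof.
move=> /convex_functionP c1 /convex_functionP c2.
apply/convex_functionP => t u v t01 Du Dv.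
by have := c1 _ _ _ t01 Du Dv; have := c2 _ _ _ t01 Du Dv; lra.
Qed.

Lemma convex_functionZ D k g : 0 <= k -> convex_function D g ->
  convex_function D (fun s => k * g s).
Proof.
move=> k0 /convex_functionP cg.
apply/convex_functionP => t u v t01 Du Dv.
have := ler_wpM2l k0 (cg _ _ _ t01 Du Dv); lra.
Qed.

(** Strict sublevel sets of a convex function are intervals. *)
Lemma convex_measurable l r g : convex_function `[l, r]%classic g ->
  measurable_fun `[l, r]%classic g.
Proof.
move=> /convex_functionP cg mD.
apply: (measurability _ (RGenInftyO.measurableE R)) => // _ [_ [a ->] <-].
apply: is_interval_measurable => u v [lru /= ua] [lrv va] s.
move=> /segment_conv[t /[dup] t01 /andP[t0 t1] ->].
move: lru lrv ua va; rewrite /= !in_itv/= => lru lrv ua va.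
have := cg _ _ _ t01 lru lrv => h; split; first by nra.
apply: (le_lt_trans h).
(* The strict inequality needs a positive weight: for [t = 0] it comes from [v] alone, otherwise
   from [u]. *)
have := t0; rewrite le_eqVlt => /predU1P[<-|tp]; first by lra.
have : 0 < t * (a - g u) by rewrite mulr_gt0// subr_gt0.
have : 0 <= (1 - t) * (a - g v) by rewrite mulr_ge0// subr_ge0// ltW.
lra.
Qed.

(** The chord gives the upper bound. Midpoint convexity, [2 * g ((l + r) / 2) <= g s + g (l + r -
    s)], combined with the upper bound at the reflected point, gives the lower one; [M] is the sum
    of the constants that arise. *)
Lemma convex_bounded l r g : convex_function `[l, r]%classic g ->
  [bounded g s | s in `[l, r]%classic].
Proof.
move=> cg; pose M := `|g l| + `|g r| + 2 * `|g ((l + r) / 2)|.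
exists M; split => [|N MN s]; first exact: num_real.
rewrite /= in_itv/= => lrs; apply/ltW/(le_lt_trans _ MN).
have mid u : l <= u <= r -> 2 * g ((l + r) / 2) <= g u + g (l + r - u).
  move=> lru; rewrite mulr_natl mulr2n; have [ulr|ulr] := leP u ((l + r) / 2).
    by apply: (convex_sum_le cg); lra.
  by rewrite [leRHS]addrC; apply: (convex_sum_le cg); lra.
have upper u : l <= u <= r -> g u <= `|g l| + `|g r|.
  move=> /[dup] lru /segment_conv[t t01 ->].
  have lr : l <= r by lra.
  apply: (le_trans ((convex_functionP _ _).1 cg _ _ _ t01 _ _)).
  - by rewrite /= in_itv/= lexx lr.
  - by rewrite /= in_itv/= lexx lr.
  - have := ler_norm (g l); have := ler_norm (g r).
    have := normr_ge0 (g l); have := normr_ge0 (g r); nra.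
have us := upper _ lrs.
have ws : g (l + r - s) <= `|g l| + `|g r| by apply: upper; lra.
have ms := mid _ lrs.
have := ler_norm (- g ((l + r) / 2)); rewrite normrN => nm.
have := normr_ge0 (g ((l + r) / 2)).
by rewrite ler_norml /M => m0; lra.
Qed.

(** A bounded measurable factor preserves integrability on the whole segment, which then restricts
    to [D]. The integrability conditions for products with the weight rest on this. *)
Lemma convex_integrableM l r D g p : convex_function `[l, r]%classic g ->
  D `<=` `[l, r]%classic -> measurable D ->
  leb.-integrable `[l, r]%classic (EFin \o p) ->
  leb.-integrable D (EFin \o (fun s => g s * p s)).
Proof.
move=> cg Dlr mD ip.
have mlr : measurable (`[l, r]%classic : set (completedR R)).
  exact: measurable_completedR (measurable_itv _).
apply: (integrableS mlr _ Dlr); first exact: measurable_completedR.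
apply: (integrableMr mlr (h := g) (g := EFin \o p)) => //.
- move=> _ B mB; apply: measurable_completedR; apply: convex_measurable => //.
- exact: convex_bounded.
Qed.

End convex.

(** For [y = y'] the two halves of [Omega] share a point. The union is split disjointly as [A] and
    [B] minus [A], and putting the null set [A] meet [B] back does not change the second
    integral. *)
Lemma Rintegral_setU_null d (T : measurableType d) (R : realType)
    (mu : {measure set T -> \bar R}) (A B : set T) (h : T -> R) :
  measurable A -> measurable B -> mu.-integrable (A `|` B) (EFin \o h) ->
  mu (A `&` B) = 0%E ->
  \int[mu]_(s in A `|` B) h s = \int[mu]_(s in A) h s + \int[mu]_(s in B) h s.
Proof.
move=> mA mB ih AB0.
have mAB : measurable (A `&` B) by exact: measurableI.
have ihA : mu.-integrable A (EFin \o h).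
  by apply: integrableS ih => //; exact: measurableU.
have ihB : mu.-integrable B (EFin \o h).
  by apply: integrableS ih => //; exact: measurableU.
have UD : A `|` (B `\` A) = A `|` B by rewrite setUDr setDv setD0.
rewrite -UD Rintegral_setU//.
- congr (_ + _); rewrite /Rintegral.
  rewrite (negligible_integral mAB mB)//; congr (fine (integral _ _ _)).
  by apply/seteqP; split => s /= [Bs]; [move=> nA; split => // -[]
    |move=> nAB; split => // As; exact: nAB].
- exact: measurableD.
- by rewrite UD.
- by apply/disj_setPS => s [/= As [_]].
Qed.

(** * Folding of [Omega] and the Fejer inequalities *)

Section fejer.
Context {R : realType} {x y y' x' : R} {p : R -> R}.
Context (ord : [/\ x < y, y <= y', y' < x' & x + x' = y + y']).
Context (hp0 : forall s, s \in `[x, x'] -> 0 <= p s).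
Context (hpint : leb.-integrable (`[x, x'] : set R) (EFin \o p)).
Context (hpsym : forall s, s \in `[x, x'] -> p s = p (x + x' - s)).
Implicit Types (g h : R -> R) (s t u v k : R).

Local Notation Om := (Omega x y y' x').
Local Notation W g := (\int[leb]_(s in Om) (g s * p s)).
Local Notation P := (\int[leb]_(s in Om) p s).
Local Notation cvx g := (convex_function `[x, x']%classic g).

Lemma measurable_Omega : measurable (Om : set R).
Proof. exact: measurableU. Qed.

Lemma sub_Omega : Om `<=` `[x, x'].
Proof. by move=> s [] /=; rewrite !in_itv/=; case: ord => *; lra. Qed.

Lemma sub_left : `[x, y] `<=` `[x, x'].
Proof. by move=> s /=; rewrite !in_itv/=; case: ord => *; lra. Qed.

Lemma sub_right : `[y', x'] `<=` `[x, x'].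
Proof. by move=> s /=; rewrite !in_itv/=; case: ord => *; lra. Qed.

Lemma mem_refl s : s \in `[x, x'] -> x + x' - s \in `[x, x'].
Proof. by rewrite !in_itv/=; case: ord => *; lra. Qed.

Lemma convex_refl g : cvx g -> cvx (fun s => g (x + x' - s)).
Proof.
move=> cg; apply: (convex_comp (h := fun s => x + x' - s) cg) => [t u v|s].
  by ring.
exact: mem_refl.
Qed.

Lemma integrable_Omega g : cvx g ->
  leb.-integrable (Om : set R) (EFin \o (fun s => g s * p s)).
Proof.
by move=> cg; exact: convex_integrableM cg sub_Omega measurable_Omega hpint.
Qed.

Lemma integrable_left g : cvx g ->
  leb.-integrable (`[x, y] : set R) (EFin \o (fun s => g s * p s)).
Proof.
by move=> cg; exact: convex_integrableM cg sub_left (measurable_itv _) hpint.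
Qed.

Lemma Omega_fold g : cvx g ->
  W g = \int[leb]_(s in `[x, y]) ((g s + g (x + x' - s)) * p s).
Proof.
move=> cg; have mitv (i : interval R) :=
  measurable_completedR (measurable_itv i).
rewrite /Omega Rintegral_setU_null//=.
- rewrite [X in _ + X](Rintegral_reflection (x + x'))//; last first.
    exact: convex_integrableM cg sub_right (measurable_itv _) hpint.
  rewrite (_ : _ @^-1` `[y', x'] = `[x, y]%classic); last first.
    by case: ord => *; apply/seteqP; split => s /=; rewrite !in_itv/=; lra.
  (* Symmetry turns the reflected weight [p (x + x' - s)] back into [p s]. *)
  under [X in _ + X]eq_Rintegral => s /set_mem/sub_left/hpsym <- do [].
  rewrite -RintegralD//; first by apply: eq_Rintegral => s _; rewrite mulrDl.
  + exact: integrable_left.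
  + exact: (integrable_left (convex_refl cg)).
- exact: integrable_Omega.
(* The overlap of the halves is contained in the singleton of [y]. *)
- apply/eqP; rewrite eq_le measure_ge0// andbT.
  rewrite -[leRHS](lebesgue_measure_set1 y); apply: le_outer_measure => s [] /=.
  by rewrite !in_itv/=; case: ord => *; apply/eqP; lra.
Qed.

Lemma convex_cst k : cvx (fun=> k).
Proof. by apply/convex_functionP => t u v _ _ _; lra. Qed.

(** Folding the constant 1 shows that [P] is twice the integral of [p] over [[x, y]], whence the
    factor [k / 2]. *)
Lemma left_cst k : \int[leb]_(s in `[x, y]) (k * p s) = k / 2 * P.
Proof.
have mxy : measurable (`[x, y]%classic : set (completedR R)).
  exact: measurable_completedR (measurable_itv _).
have ixy : leb.-integrable (`[x, y] : set R) (EFin \o p).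
  by apply: (@integrableS _ (completedR R) _ _ _ _ _ _ _ sub_left hpint);
    exact: measurable_completedR (measurable_itv _).
have := Omega_fold (convex_cst 1).
rewrite (_ : (fun s => 1 * p s) = p); last by apply/funext => s; rewrite mul1r.
by rewrite RintegralZl// => ->; rewrite RintegralZl//; field.
Qed.

Lemma fejer_ge g : cvx g -> (g y + g y') / 2 * P <= W g.
Proof.
move=> cg; rewrite -left_cst Omega_fold//.
apply: le_Rintegral => //.
- exact: measurable_completedR (measurable_itv _).
- exact: (integrable_left (convex_cst _)).
- exact: (integrable_left (convex_functionD cg (convex_refl cg))).
- move=> s xys; apply: ler_wpM2r; first by apply/hp0/sub_left.
  move: xys; rewrite /= in_itv/=; case: ord => *.
  apply: (convex_sum_le cg); lra.
Qed.

Lemma fejer_le g : cvx g -> W g <= (g x + g x') / 2 * P.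
Proof.
move=> cg; rewrite -left_cst Omega_fold//.
apply: le_Rintegral => //.
- exact: measurable_completedR (measurable_itv _).
- exact: (integrable_left (convex_functionD cg (convex_refl cg))).
- exact: (integrable_left (convex_cst _)).
- move=> s xys; apply: ler_wpM2r; first by apply/hp0/sub_left.
  move: xys; rewrite /= in_itv/=; case: ord => *.
  apply: (convex_sum_le cg); lra.
Qed.

(** The folded function [h] is integrated together with its reversal on [[x, y]]. The pair
    [(s, x + y - s)] is nested in [(x, y)], so [h s + h (x + y - s) <= h x + h y], and this bound is
    the sum of [g] over the four endpoints. *)
Lemma fejer_le_left g : (forall s, s \in `[x, y] -> p s = p (x + y - s)) ->
  cvx g -> W g <= (g x + g x' + g y + g y') / 4 * P.
Proof.
move=> psym cg; pose h s := g s + g (x + x' - s).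
have ch : cvx h := convex_functionD cg (convex_refl cg).
pose hr s := h (x + y - s).
(* Convexity is claimed on [[x, y]] only: for [s] beyond [y] the point [x + y - s] leaves
   [[x, x']]. *)
have chr : convex_function `[x, y]%classic hr.
  apply: (convex_comp (h := fun s => x + y - s) ch) => [t u v|s].
    by ring.
  by rewrite /= !in_itv/=; case: ord => *; lra.
have mxy : measurable (`[x, y]%classic : set (completedR R)).
  exact: measurable_completedR (measurable_itv _).
have ih := integrable_left ch.
have ixy : leb.-integrable (`[x, y] : set R) (EFin \o p).
  by apply: (@integrableS _ (completedR R) _ _ _ _ _ _ _ sub_left hpint);
    exact: measurable_completedR (measurable_itv _).
have ihr : leb.-integrable (`[x, y] : set R) (EFin \o (fun s => hr s * p s)).
  by apply: (convex_integrableM chr).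
have WE : W g = \int[leb]_(s in `[x, y]) (hr s * p s).
  rewrite Omega_fold// (Rintegral_reflection (x + y))//.
  rewrite (_ : _ @^-1` `[x, y] = `[x, y]%classic); last first.
    by apply/seteqP; split => s /=; rewrite !in_itv/=; lra.
  by apply: eq_Rintegral => s /set_mem/psym <-.
have : W g + W g <= (h x + h y) / 2 * P.
  rewrite {1}Omega_fold// WE -RintegralD// -left_cst.
  under eq_Rintegral do rewrite -mulrDl.
  apply: le_Rintegral => //.
  - apply: eq_integrable (integrableD mxy ih ihr) => // s _.
    by rewrite /= -EFinD -mulrDl.
  - exact: (integrable_left (convex_cst _)).
  - move=> s xys; apply: ler_wpM2r; first by apply/hp0/sub_left.
    move: xys; rewrite /= in_itv/=; case: ord => *.
    apply: (convex_sum_le ch); [exact: lexx|lra|lra|lra].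
rewrite /h; have -> : x + x' - x = x' by ring.
have -> : x + x' - y = y' by case: ord => *; lra.
lra.
Qed.

Lemma le_Omega g h : cvx g -> cvx h -> (forall s, Om s -> g s <= h s) ->
  W g <= W h.
Proof.
move=> cg ch gh; apply: le_Rintegral => //.
- exact: (measurable_completedR measurable_Omega).
- exact: integrable_Omega.
- exact: integrable_Omega.
- by move=> s Os; rewrite ler_wpM2r ?gh//; apply/hp0/sub_Omega.
Qed.

Lemma le_left g h : cvx g -> cvx h ->
  (forall s, s \in `[x, y] -> g s <= h s) ->
  \int[leb]_(s in `[x, y]) (g s * p s) <= \int[leb]_(s in `[x, y]) (h s * p s).
Proof.
move=> cg ch gh; apply: le_Rintegral => //.
- exact: measurable_completedR (measurable_itv _).
- exact: integrable_left.
- exact: integrable_left.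
- by move=> s xys; rewrite ler_wpM2r ?gh//; apply/hp0/sub_left.
Qed.

Lemma leftD g h : cvx g -> cvx h ->
  \int[leb]_(s in `[x, y]) ((g s + h s) * p s) =
  \int[leb]_(s in `[x, y]) (g s * p s) + \int[leb]_(s in `[x, y]) (h s * p s).
Proof.
move=> cg ch; rewrite -RintegralD.
- by apply: eq_Rintegral => s _; rewrite mulrDl.
- exact: measurable_completedR (measurable_itv _).
- exact: integrable_left.
- exact: integrable_left.
Qed.

Lemma OmegaD g h : cvx g -> cvx h -> W (fun s => g s + h s) = W g + W h.
Proof.
move=> cg ch; rewrite -RintegralD.
- by apply: eq_Rintegral => s _; rewrite mulrDl.
- exact: (measurable_completedR measurable_Omega).
- exact: integrable_Omega.
- exact: integrable_Omega.
Qed.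

Lemma OmegaZ k g : cvx g -> W (fun s => k * g s) = k * W g.
Proof.
move=> cg; rewrite -RintegralZl.
- by apply: eq_Rintegral => s _; rewrite mulrA.
- exact: (measurable_completedR measurable_Omega).
- exact: integrable_Omega.
Qed.

(** Convexity in the parameter is integrated pointwise; convexity in [s] supplies integrability. It
    yields convexity of [Lp1] in [t] and of the inner integral of [Fp1] in [u]. *)
Lemma convex_Omega (D : set R) (G : R -> R -> R) :
  (forall t, D t -> cvx (G t)) ->
  (forall s, s \in `[x, x'] -> convex_function D (G^~ s)) ->
  (forall t u v, 0 <= t <= 1 -> D u -> D v -> D (t * u + (1 - t) * v)) ->
  convex_function D (fun t => W (G t)).
Proof.
move=> cG1 cG2 cD; apply/convex_functionP => t u v t01 Du Dv.
have [t0 t1] := andP t01.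
have cu : cvx (fun s => t * G u s) by apply/convex_functionZ/cG1.
have cv : cvx (fun s => (1 - t) * G v s).
  by apply/convex_functionZ/cG1 => //; rewrite subr_ge0.
rewrite -(OmegaZ t (cG1 _ Du)) -(OmegaZ (1 - t) (cG1 _ Dv)) -(OmegaD cu cv).
apply: le_Omega.
- exact/cG1/cD.
- exact: convex_functionD.
- by move=> s /sub_Omega/cG2/convex_functionP; exact.
Qed.

End fejer.

(** * The functionals as weighted integrals of convex functions, and the four claims *)

Lemma conv_segment (R : realType) (a b t u v : R) : 0 <= t <= 1 ->
  u \in `[a, b] -> v \in `[a, b] -> t * u + (1 - t) * v \in `[a, b].
Proof. by rewrite !in_itv/=; nra. Qed.

Theorem theorem7 (R : realType) (a b x y y' x' : R) (f p : R -> R)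
  (hax : a <= x) (hxy : x < y) (hyy' : y <= y') (hy'x' : y' < x')
  (hx'b : x' <= b) (hsum : x + x' = y + y')
  (hf : convex_function (`[a, b] : set R) f)
  (hp0 : forall s, s \in `[x, x'] -> 0 <= p s)
  (hpint : leb.-integrable (`[x, x'] : set R) (EFin \o p))
  (hpsym : forall s, s \in `[x, x'] -> p s = p (x + x' - s)) :
  let Lp1 := Lp1 f p x y y' x' in
  let Pp1 := Pp1 f p x y x' in
  let G1 := G1 f x y y' x' in
  let G2 := G2 f x y y' x' in
  let Hp1 := Hp1 f p x y y' in
  let Hp2 := Hp2 f p x y y' in
  let Fp1 := Fp1 f p x y y' x' in
  let P : R := \int[leb]_(s in Omega x y y' x') p s in
  [/\ (* (1) *)
      convex_function (`[0, 1] : set R) Lp1,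
      (* (2) *)
      [/\ forall t, t \in `[0, 1] ->
            (G1 t + G2 t) / 2 * P <= Lp1 t <= Pp1 t,
          ereal_sup [set (Lp1 t)%:E | t in `[0, 1]] = (Lp1 1)%:E
        & Lp1 1 = (f x + f x') / 2 * P],
      (* (3) *)
      forall t, t \in `[0, 1] ->
        [/\ (Hp1 (1 - t) + Hp2 (1 - t)) / 2 * P <= Fp1 t <= Lp1 t * P,
            (Hp1 t + Hp2 t) / 2 * P <= Fp1 t <= Lp1 t * P
          & (Hp1 t + Hp2 t + Hp1 (1 - t) + Hp2 (1 - t)) / 4 * P
              <= Fp1 t <= Lp1 t * P]
    & (* (4) *)
      (forall s, s \in `[x, y] -> p s = p (x + x' - s)) ->
      (forall s, s \in `[x, (x + y) / 2] -> p s = p (x + y - s)) ->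
      forall t, t \in `[0, 1] ->
        0 <= Fp1 t - (Hp1 t + Hp2 t) / 2 * P <= Lp1 (1 - t) * P - Fp1 t].

Proof.
move=> /=.
have ord : [/\ x < y, y <= y', y' < x' & x + x' = y + y'] by [].
have xI : x \in `[x, x'] by rewrite in_itv/=; lra.
have x'I : x' \in `[x, x'] by rewrite in_itv/=; lra.
have yI : y \in `[x, x'] by rewrite in_itv/=; lra.
have y'I : y' \in `[x, x'] by rewrite in_itv/=; lra.
have sub s : s \in `[x, x'] -> s \in `[a, b] by rewrite !in_itv/=; lra.
pose P : R := \int[leb]_(s in Omega x y y' x') p s.
have P0 : 0 <= P by apply: Rintegral_ge0 => s /(sub_Omega ord)/hp0.
(* The kernel [f (t * s + (1 - t) * u)] is convex in each variable separately: [cl] in [s], [cr] in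
   [u], [ct] in [t]. *)
have cl (t u : R) : t \in `[0, 1] -> u \in `[x, x'] ->
    convex_function `[x, x']%classic (fun s => f (t * s + (1 - t) * u)).
  rewrite in_itv/= => t01 uI.
  apply: (convex_comp (h := fun s => t * s + (1 - t) * u) hf) => [k v w|s sI].
    by ring.
  by apply: conv_segment => //; apply: sub.
have cr (t s : R) : t \in `[0, 1] -> s \in `[x, x'] ->
    convex_function `[x, x']%classic (fun u => f (t * s + (1 - t) * u)).
  rewrite in_itv/= => t01 sI.
  apply: (convex_comp (h := fun u => t * s + (1 - t) * u) hf) => [k v w|u uI].
    by ring.
  by apply: conv_segment => //; apply: sub.
have ct (s u : R) : s \in `[x, x'] -> u \in `[x, x'] ->
    convex_function (`[0, 1]%classic : set R)
      (fun t : R => f (t * s + (1 - t) * u)).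
  move=> sI uI.
  apply: (convex_comp (h := fun t => t * s + (1 - t) * u) hf) => [k v w|t].
    by ring.
  by rewrite /= in_itv/= => t01; apply: conv_segment => //; apply: sub.
have c01 (t : R) : t \in `[0, 1] -> 1 - t \in `[0, 1] by rewrite !in_itv/=; lra.
have c1 : (1 : R) \in `[0, 1] by rewrite in_itv/=; lra.
pose W g := \int[leb]_(s in Omega x y y' x') (g s * p s).
(* [Fu] integrates out the variable of weight [t], [Gu] the one of weight [1 - t]; replacing [t] by
   [1 - t] exchanges them. *)
pose Fu t u := W (fun s => f (t * s + (1 - t) * u)).
pose Gu t u := W (fun s => f (t * u + (1 - t) * s)).
have FGu t u : Fu (1 - t) u = Gu t u.
  by apply: eq_Rintegral => s _; congr (f _ * _); ring.
have LpE t : t \in `[0, 1] -> Lp1 f p x y y' x' t = 2^-1 * (Gu t x + Gu t x').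
  by move=> tI; rewrite /Gu -(OmegaD ord hpint (cr t x tI xI) (cr t x' tI x'I)).
(* Folding the right side gives four integrals over [[x, y]]. [Hp1] and [Hp2] group the same four
   crosswise, each combining one term with [y] and one with [y']. *)
have HpE t : t \in `[0, 1] ->
    Hp1 f p x y y' t + Hp2 f p x y y' t = Fu t y + Fu t y'.
  move=> tI; rewrite /Fu /W.
  have cly := cl t y tI yI; have cly' := cl t y' tI y'I.
  have cly_ := convex_refl ord cly; have cly'_ := convex_refl ord cly'.
  rewrite !(Omega_fold ord hpint hpsym)//.
  rewrite /Hp1 /Hp2 -hsum !(leftD ord hpint)//.
  ring.
have cFu t : t \in `[0, 1] -> convex_function `[x, x']%classic (Fu t).
  move=> tI; apply: (convex_Omega ord hp0 hpint) => [u uI|s sI|k u v k01].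
  - exact: cl.
  - exact: cr.
  - exact: conv_segment.
have FpE t : t \in `[0, 1] -> Fp1 f p x y y' x' t = W (Fu t).
  move=> tI; apply: eq_Rintegral => u /set_mem/(sub_Omega ord) uI.
  rewrite /Fu /W -RintegralZr//.
  - exact: (measurable_completedR measurable_Omega).
  - exact: (integrable_Omega ord hpint (cl _ _ tI uI)).
have Lp1_1 : Lp1 f p x y y' x' 1 = (f x + f x') / 2 * P.
  have G1 u : Gu 1 u = f u * P.
    rewrite -[RHS]mulrC -[P]/(Rintegral _ _ _).
    rewrite /Gu /W; under eq_Rintegral do rewrite mul1r subrr mul0r addr0.
    rewrite RintegralZl; first by rewrite mulrC.
      exact: (measurable_completedR measurable_Omega).
    apply: (@integrableS _ (completedR R) _ _ _ _ _ _ _ (sub_Omega ord) hpint).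
      exact: (measurable_completedR (measurable_itv _)).
    exact: (measurable_completedR measurable_Omega).
  by rewrite LpE// !G1; field.
have Lp_le1 t : t \in `[0, 1] -> Lp1 f p x y y' x' t <= Lp1 f p x y y' x' 1.
  move=> tI; rewrite Lp1_1 LpE//.
  have := fejer_le ord hp0 hpint hpsym (cr t x tI xI).
  have := fejer_le ord hp0 hpint hpsym (cr t x' tI x'I).
  rewrite -/P -!/(W _) -!/(Gu _ _).
  (* The Fejer bounds for [Gu t x] and [Gu t x'] involve [f x], [f x'] and these two mixed values,
     whose arguments form a pair nested in [(x, x')]. *)
  have fle : f (t * x + (1 - t) * x') + f (t * x' + (1 - t) * x) <= f x + f x'.
    by move: tI; rewrite in_itv/= => tI; apply: (convex_sum_le hf); nra.
  have -> : t * x + (1 - t) * x = x by ring.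
  have -> : t * x' + (1 - t) * x' = x' by ring.
  have := ler_wpM2r P0 fle; lra.
have Lp_ge t : t \in `[0, 1] ->
    (G1 f x y y' x' t + G2 f x y y' x' t) / 2 * P <= Lp1 f p x y y' x' t.
  move=> tI; rewrite LpE//.
  have := fejer_ge ord hp0 hpint hpsym (cr t x tI xI).
  have := fejer_ge ord hp0 hpint hpsym (cr t x' tI x'I).
  rewrite -/P -!/(W _) -!/(Gu _ _) /G1 /G2; lra.
(* Of the four terms of the folded [2 * Lp1 t], two are those of [Pp1 t]. The other two have
   arguments nested between theirs with the same sum, because [s <= x + x' - s] on [[x, y]]; hence
   [2 * Lp1 t <= 2 * Pp1 t]. *)
have Lp_le t : t \in `[0, 1] -> Lp1 f p x y y' x' t <= Pp1 f p x y x' t.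
  move=> tI; rewrite LpE// /Gu /W /Pp1.
  have cx := cr t x tI xI; have cx' := cr t x' tI x'I.
  have cx_ := convex_refl ord cx; have cx'_ := convex_refl ord cx'.
  rewrite !(Omega_fold ord hpint hpsym)// !(leftD ord hpint)//.
  have := le_left ord hp0 hpint (convex_functionD cx_ cx')
    (convex_functionD cx cx'_).
  rewrite !(leftD ord hpint)// => h.
  suff /h : forall s, s \in `[x, y] -> f (t * x + (1 - t) * (x + x' - s)) +
      f (t * x' + (1 - t) * s) <= f (t * x + (1 - t) * s) +
      f (t * x' + (1 - t) * (x + x' - s)) by lra.
  move=> s; rewrite in_itv/= => xsy; rewrite in_itv/= in tI.
  by apply: (convex_sum_le hf); nra.
(* Fejer for the outer integral, applied to the convex function [Fu t]. *)
have Fp_ge1 t : t \in `[0, 1] ->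
    (Hp1 f p x y y' t + Hp2 f p x y y' t) / 2 * P <= Fp1 f p x y y' x' t.
  by move=> tI; rewrite HpE// FpE//;
    exact: (fejer_ge ord hp0 hpint hpsym (cFu t tI)).
have cGG t u v : t \in `[0, 1] -> u \in `[x, x'] -> v \in `[x, x'] ->
    convex_function `[x, x']%classic
      (fun s => f (t * u + (1 - t) * s) + f (t * v + (1 - t) * s)).
  by move=> tI uI vI; apply: convex_functionD; exact: cr.
have P20 : 0 <= P / 2 by lra.
have WGG t u v : t \in `[0, 1] -> u \in `[x, x'] -> v \in `[x, x'] ->
    W (fun s => P / 2 * (f (t * u + (1 - t) * s) + f (t * v + (1 - t) * s)))
    = P / 2 * (Gu t u + Gu t v).
  move=> tI uI vI; rewrite /W (OmegaZ ord hpint _ (cGG t u v tI uI vI)).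
  by rewrite (OmegaD ord hpint)//; exact: cr.
(* Fejer for the inner integral at each fixed [u], then integrated in [u]; the factor [P / 2] is the
   one in the Fejer bound. *)
have Fp_ge2 t : t \in `[0, 1] ->
    (Hp1 f p x y y' (1 - t) + Hp2 f p x y y' (1 - t)) / 2 * P
    <= Fp1 f p x y y' x' t.
  move=> tI; rewrite HpE ?c01// FpE// !FGu.
  apply: (@le_trans _ _ (P / 2 * (Gu t y + Gu t y'))); first by lra.
  rewrite -WGG//; apply: (le_Omega ord hp0 hpint).
  - by apply: convex_functionZ => //; exact: cGG.
  - exact: cFu.
  - move=> u /(sub_Omega ord) uI.
    have := fejer_ge ord hp0 hpint hpsym (cl t u tI uI).
    by rewrite -/P -/(W _) -/(Fu _ _); lra.
have Fp_le t : t \in `[0, 1] ->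
    Fp1 f p x y y' x' t <= Lp1 f p x y y' x' t * P.
  move=> tI; rewrite LpE// FpE//.
  apply: (@le_trans _ _ (P / 2 * (Gu t x + Gu t x'))); last by lra.
  rewrite -WGG//; apply: (le_Omega ord hp0 hpint).
  - exact: cFu.
  - by apply: convex_functionZ => //; exact: cGG.
  - move=> u /(sub_Omega ord) uI.
    have := fejer_le ord hp0 hpint hpsym (cl t u tI uI).
    by rewrite -/P -/(W _) -/(Fu _ _); lra.
rewrite -/P; split.
- apply: convex_functionZ => //; apply: (convex_Omega ord hp0 hpint).
  + by move=> t tI; exact: cGG.
  + by move=> s sI; apply: convex_functionD; exact: ct.
  + by move=> t u v t01; exact: conv_segment.
- split => [t tI||//]; first by rewrite Lp_ge// Lp_le.
  apply/eqP; rewrite eq_le; apply/andP; split.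
    by apply: ge_ereal_sup => _ [t tI <-]; rewrite lee_fin Lp_le1.
  by apply: ereal_sup_ubound; exists 1.
(* The third lower bound is the average of the first two. *)
- move=> t tI; have := Fp_ge1 t tI; have := Fp_ge2 t tI; have := Fp_le t tI.
  by move=> h1 h2 h3; split; apply/andP; split => //; lra.
- move=> _ psym t tI; rewrite subr_ge0 Fp_ge1//=.
  (* The symmetry is assumed on the left half of [[x, y]]; a point of the right half is reflected
     into it. *)
  have psym' s : s \in `[x, y] -> p s = p (x + y - s).
    rewrite in_itv/= => xsy; have [sm|sm] := leP s ((x + y) / 2).
      by apply: psym; rewrite in_itv/=; lra.
    by rewrite [RHS]psym ?in_itv/=; [congr p; ring|lra].
  (* This bounds [Fp1 t] by a quarter of [P] times the sum of [Fu t] over the four endpoints. The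
     values at [x], [x'] add up to [2 * Lp1 (1 - t)] and those at [y], [y'] to [Hp1 t + Hp2 t];
     doubling and rearranging gives the claim. *)
  have := fejer_le_left ord hp0 hpint hpsym psym' (cFu t tI).
  rewrite -/P -/(W _) HpE// FpE// LpE ?c01//.
  rewrite -!FGu; have -> : 1 - (1 - t) = t by ring.
  lra.
Qed.
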